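(* For any positive integer $g$, if a $g$-wide signed graph $(B,\pi)$ is $\mathcal{SP}$-complete, then its Extended Double Cover ${\rm EDC}(B,\pi)$ is also $\mathcal{SP}$-complete.
   Context: A signed graph $(G,\sigma)$ is a graph $G$ (loops and parallel edges allowed) with a signature $\sigma:E(G)\to\{+,-\}$. The sign of a closed walk is the product of the signs of its edges, counted with multiplicity. Switching at a vertex set $X$ multiplies by $-$ the sign of every edge in the cut $(X,V(G)\setminus X)$; two signatures are switching equivalent if one is obtained from the other by a switching. A closed walk is of type $ij\in\mathbb{Z}_2^2$ where $i=0$ if it is positive and $i=1$ if negative, and $j$ is the parity of its length. $g_{ij}(G,\sigma)$ is the minimum length of a closed walk of type $ij$ in $(G,\sigma)$ ($\infty$ if none exists). $C_{-g}$ denotes a cycle of length $g$ with an odd number of negative edges (for $g=1$ a negative loop, for $g=2$ two parallel edges of opposite signs). A signed graph $(G,\sigma)$ is $g$-wide if $g_{ij}(G,\sigma)\ge g_{ij}(C_{-g})$ for every $ij\in\mathbb{Z}_2^2$. A homomorphism of $(G,\sigma)$ to $(H,\pi)$ consists of a signature $\sigma'$ switching equivalent to $\sigma$ together with a mapping of vertices of $G$ to vertices of $H$ and edges of $G$ to edges of $H$ preserving adjacencies and incidences and such that every edge $e$ is mapped to an edge of sign $\sigma'(e)$. $\mathcal{SP}$ denotes the class of signed graphs $(G,\sigma)$ where $G$ is a simple connected $K_4$-minor-free graph. A signed graph $(B,\pi)$ is $\mathcal{SP}$-complete if every $(G,\sigma)\in\mathcal{SP}$ satisfying $g_{ij}(G,\sigma)\ge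 g_{ij}(B,\pi)$ for every $ij\in\mathbb{Z}_2^2$ admits a homomorphism to $(B,\pi)$. The Extended Double Cover ${\rm EDC}(G,\sigma)$ is the signed graph on vertex set $\{v^+,v^-: v\in V(G)\}$ where: for each vertex $x$, $x^+x^-$ is a negative edge; for each positive edge $uv$ of $(G,\sigma)$, $u^+v^+$ and $u^-v^-$ are positive edges; for each negative edge $uv$ of $(G,\sigma)$, $u^+v^-$ and $u^-v^+$ are positive edges; there are no other edges. *)

(* Defs.v *)
From mathcomp Require Import all_boot.
From mathcomp Require Import boolp.

Set Implicit Arguments.
Unset Strict Implicit.
Unset Printing Implicit Defensive.

(* Finite graphs with loops and parallel edges.  The ordered pair [ends e] only
   records the two end-vertices of [e]: graphs are undirected, and every notion
   below goes through the symmetric incidence relation [joins] or is otherwise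
   insensitive to the order. *)
Record mgraph := MGraph {
  vertex : finType;
  edge : finType;
  ends : edge -> vertex * vertex }.
Arguments ends {m} _.

(* Signs are booleans: [true] is the negative sign, [false] the positive one, so
   that the product of signs is the exclusive or [addb]. *)
Definition signature (G : mgraph) := edge G -> bool.

Record sgraph := SGraph {
  ugraph :> mgraph;
  sign : signature ugraph }.
Arguments sign {s} _.

Section Graph.
Variable G : mgraph.
Implicit Types (x y : vertex G) (e : edge G) (S : {set vertex G}).

Definition joins e x y : bool := (ends e == (x, y)) || (ends e == (y, x)).

Definition adjacent x y : bool := [exists e, joins e x y].

Definition simple : bool :=
  [forall e : edge G, (ends e).1 != (ends e).2] &&
  [forall e : edge G, forall e' : edge G, joins e' (ends e).1 (ends e).2 ==> (e == e')].

(* The subgraph induced by S is nonempty and connected. *)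
Definition connected_set S : bool :=
  (S != set0) &&
  [forall x in S, forall y in S,
     connect [rel u v | [&& u \in S, v \in S & adjacent u v]] x y].

Definition connected : bool := connected_set setT.

(* A complete graph on n vertices is a minor: there are n disjoint connected
   branch sets, pairwise joined by an edge. *)
Definition clique_minor (n : nat) : bool :=
  [exists phi : {ffun 'I_n -> {set vertex G}},
     [forall i, connected_set (phi i)] &&
     [forall i, forall j, (i != j) ==>
        [disjoint phi i & phi j] &&
        [exists x in phi i, exists y in phi j, adjacent x y]]].

Definition cut S e : bool := ((ends e).1 \in S) (+) ((ends e).2 \in S).

Definition switch S (s : signature G) : signature G := fun e => s e (+) cut S e.

Definition switching_equivalent (s s' : signature G) : Prop :=
  exists S, s' =1 switch S s.

(* A walk from x to y is the list of its successive (edge, next vertex) steps. *)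
Fixpoint walk x (p : seq (edge G * vertex G)) y : bool :=
  if p is (e, z) :: p' then joins e x z && walk z p' y else x == y.

End Graph.

Section SignedGraph.
Variable G : sgraph.

Definition walk_sign (p : seq (edge G * vertex G)) : bool :=
  \big[addb/false]_(a <- p) sign a.1.

Definition closed_walk_length (i j : bool) (n : nat) : bool :=
  [exists x : vertex G, exists p : n.-tuple (edge G * vertex G),
     [&& walk x p x, walk_sign p == i & odd n == j]].

(* g_ij, with [None] for infinity.  The trivial closed walk of length 0 counts as
   a closed walk of type 00. *)
Definition girth (i j : bool) : option nat :=
  if pselect (exists n, closed_walk_length i j n) is left ex
  then Some (ex_minn ex) else None.

End SignedGraph.

Definition le_inf (a b : option nat) : bool :=
  match a, b with
  | _, None => true
  | None, Some _ => false
  | Some m, Some n => m <= n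
  end.

Definition girth_ge (G H : sgraph) : Prop :=
  forall i j : bool, le_inf (girth H i j) (girth G i j).

(* The cycle C_{-g}, for g > 0, with edge k joining k to k + 1 modulo g and
   exactly one negative edge; all signatures of this cycle with an odd number of
   negative edges are switching equivalent.  It is a negative loop for g = 1 and
   two parallel edges of opposite signs for g = 2. *)
Definition neg_cycle (g : nat) : sgraph :=
  @SGraph (@MGraph 'I_g 'I_g (fun k => (k, ordS k))) (fun k => val k == 0).

Definition wide (g : nat) (G : sgraph) : Prop := girth_ge G (neg_cycle g).

Definition homomorphic (G H : sgraph) : Prop :=
  exists s' : signature G, switching_equivalent (@sign G) s' /\
  exists (fV : vertex G -> vertex H) (fE : edge G -> edge H),
    (forall (e : edge G) (x y : vertex G),
       joins e x y -> joins (fE e) (fV x) (fV y)) /\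
    (forall e, sign (fE e) = s' e).

Definition SP (G : sgraph) : bool :=
  [&& simple G, connected G & ~~ clique_minor G 4].

Definition SP_complete (B : sgraph) : Prop :=
  forall G : sgraph, SP G -> girth_ge G B -> homomorphic G B.

(* The vertex (v, false) is v^+ and (v, true) is v^-.  The edge inl x joins x^+ to
   x^-; an edge e = uv of G lifts to inr (e, false), incident with u^+, and
   inr (e, true), incident with u^-.  A negative loop at v thus lifts to two
   parallel positive edges between v^+ and v^-. *)
Definition EDC_graph (G : sgraph) : mgraph :=
  @MGraph (vertex G * bool)%type (vertex G + edge G * bool)%type
    (fun a => match a with
     | inl x => ((x, false), (x, true))
     | inr (e, b) => (((ends e).1, b), ((ends e).2, b (+) sign e))
     end).

Definition EDC (G : sgraph) : sgraph :=
  @SGraph (EDC_graph G) (fun a => if a is inl _ then true else false).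

(* Main.v *)
Require Import Defs.
From mathcomp Require Import all_boot.
From mathcomp Require Import boolp zify.

Set Implicit Arguments.
Unset Strict Implicit.
Unset Printing Implicit Defensive.

(* Wideness forces every negative closed walk of B to have the parity of g and
   every positive one to be even.  Let n be the length of a shortest negative
   closed walk of B.  If G satisfies the girth conditions of EDC(B), its negative
   closed walks have length at least k = n + 1 and the parity of k.  Then G maps
   to the signed projective cube of dimension n: up to switching, the vertices of
   G get 0/1-vectors of length n such that a positive edge flips exactly one
   coordinate and a negative edge flips all of them.  To see this, give each pair
   of vertices a target Hamming distance t in {0,1}^k, with t at most the length
   of any positive walk and k - t at most the length of any negative walk between
   them, and t as close to k/2 as possible.  Every triple of such distances is
   realizable, so vectors can be chosen greedily along an elimination order
   of the K_4-minor-free graph G, in which each vertex is removed with at most two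
   neighbours (which are then made adjacent).
   Contracting the negative edges yields a K_4-minor-free graph, simple for
   n >= 3, whose negative closed walks have length at least n; it maps to B by
   completeness, and the first coordinate tells x^+ from x^-.  For n = 1, 2 the
   vectors themselves map G into the double cover of a negative loop or of two
   parallel edges of opposite signs. *)

(** * Clique minors *)

Definition induced (T : finType) (e : rel T) (S : {set T}) : rel T :=
  [rel u v | [&& u \in S, v \in S & e u v]].

(* Same shape as [connected_set] and [clique_minor], so that these are convertible
   to the instances at [e := @adjacent G]. *)
Definition rel_connected (T : finType) (e : rel T) (S : {set T}) : bool :=
  (S != set0) &&
  [forall x in S, forall y in S,
     connect [rel u v | [&& u \in S, v \in S & e u v]] x y].

Definition rel_clique_minor (T : finType) (e : rel T) (n : nat) : bool :=
  [exists phi : {ffun 'I_n -> {set T}},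
     [forall i, rel_connected e (phi i)] &&
     [forall i, forall j, (i != j) ==>
        [disjoint phi i & phi j] &&
        [exists x in phi i, exists y in phi j, e x y]]].

Lemma rel_connectedP (T : finType) (e : rel T) (S : {set T}) :
  reflect ((exists x, x \in S) /\
    {in S &, forall x y, connect (induced e S) x y}) (rel_connected e S).
Proof.
apply: (iffP andP) => [[/set0Pn ne /forall_inP H]|[ne H]]; split=> //.
- by move=> x y xS yS; move/forall_inP: (H x xS); apply.
- exact/set0Pn.
- by apply/forall_inP => x xS; apply/forall_inP => y yS; apply: H.
Qed.

Lemma rel_connected1 (T : finType) (e : rel T) x : rel_connected e [set x].
Proof.
apply/rel_connectedP; split; first by exists x; rewrite inE.
by move=> y z /set1P-> /set1P->.
Qed.

Lemma rel_clique_minorP (T : finType) (e : rel T) n :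
  reflect (exists phi : 'I_n -> {set T},
     (forall i, rel_connected e (phi i)) /\
     forall i j, i != j -> [disjoint phi i & phi j] /\
        exists x y, [/\ x \in phi i, y \in phi j & e x y])
    (rel_clique_minor e n).
Proof.
apply: (iffP existsP) => [[phi /andP[/forallP cphi /forallP H]]|[phi [cphi H]]].
  exists phi; split=> // i j ij.
  move/forallP/(_ j)/implyP/(_ ij)/andP: (H i) => [-> /exists_inP[x xi]].
  by move=> /exists_inP[y yj exy]; split=> //; exists x, y.
exists (finfun phi); apply/andP; split; apply/forallP => i.
  by rewrite ffunE.
apply/forallP => j; apply/implyP => /H[dij [x [y [xi yj exy]]]].
rewrite !ffunE dij; apply/exists_inP; exists x => //.
by apply/exists_inP; exists y.
Qed.

(* [f] maps each vertex of the minor to its branch set. *)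
Lemma clique_minor_lift (T T' : finType) (e : rel T) (e' : rel T')
    (f : T' -> {set T}) n :
    (forall x, rel_connected e (f x)) ->
    (forall x y, x != y -> [disjoint f x & f y]) ->
    (forall x y, e' x y -> exists a b, [/\ a \in f x, b \in f y & e a b]) ->
  rel_clique_minor e' n -> rel_clique_minor e n.
Proof.
move=> cf df ef /rel_clique_minorP[phi [cphi H]].
apply/rel_clique_minorP; exists (fun i => \bigcup_(y in phi i) f y); split.
  move=> i; have /rel_connectedP[[z zi] ci] := cphi i.
  set S := \bigcup_(_ in _) _.
  have fS y : y \in phi i -> {subset f y <= S}.
    by move=> yi a ay; apply/bigcupP; exists y.
  have cfS y : y \in phi i -> {in f y &, forall a b, connect (induced e S) a b}.
    move=> yi a b ay by_; have /rel_connectedP[_ /(_ a b ay by_)] := cf y.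
    apply: connect_sub => u v /and3P[uy vy euv]; apply: connect1.
    by rewrite /induced /= euv !andbT; apply/andP; split; apply: fS yi _ _.
  apply/rel_connectedP; split.
    have /rel_connectedP[[a az] _] := cf z; exists a; exact: fS az.
  move=> a b /bigcupP[y yi ay] /bigcupP[y' yi' by'].
  have /connectP[p] := ci y y' yi yi'.
  elim: p y yi a ay => [|w p IH] y yi a ay /=.
    by move=> _ E; rewrite E in by'; apply: (cfS y).
  case/andP=> /and3P[_ wi /ef[u [v [uy vw euv]]]] pw lw.
  apply: connect_trans (IH w wi v vw pw lw).
  apply: connect_trans (cfS y yi a u ay uy) (connect1 _).
  by rewrite /induced /= euv andbT; apply/andP; split; [apply: fS yi _ _|apply: fS wi _ _].
move=> i j /H[dij [x [y [xi yj /ef[a [b [ax by_ eab]]]]]]]; split.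
  apply/pred0P => c; apply/negbTE/negP => /andP[/bigcupP[u ui cu]].
  case/bigcupP=> v vj cv; case: (eqVneq u v) => [uv|/df].
    by move/pred0P: dij => /(_ u); rewrite /= ui uv vj.
  by move/pred0P/(_ c); rewrite /= cu cv.
exists a, b; split=> //; apply/bigcupP; [by exists x|by exists y].
Qed.

(** * A graph without K_4 minor has a vertex of degree at most 2 *)

(** [a] and [b] may coincide or fail to be neighbours, so this bounds the degree by 2 without
    counting. *)
Definition low_degree (T : finType) (e : rel T) x :=
  exists a b, forall y, e x y -> y = a \/ y = b.

Section Sub.
Variables (T : finType) (e : rel T) (P : pred T).

Lemma clique_minor_sub n :
  rel_clique_minor (fun x y : {x | P x} => e (val x) (val y)) n ->
  rel_clique_minor e n.
Proof.
apply: (@clique_minor_lift _ _ _ _ (fun x => [set val x])).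
- by move=> x; apply: rel_connected1.
- move=> x y xy; rewrite disjoints1 inE; apply: contra xy => /eqP E.
  exact/eqP/val_inj.
- by move=> x y exy; exists (val x), (val y); rewrite !inE !eqxx.
Qed.

End Sub.

Lemma card_sub_lt (T : finType) (P : pred T) (v : T) :
  ~~ P v -> #|{: {x | P x}}| < #|T|.
Proof.
move=> Pv; rewrite card_sig; apply: proper_card.
apply/properP; split; first exact/subsetP.
by exists v.
Qed.

Section Contract.
Variables (T : finType) (e : rel T) (u v : T).
Hypotheses (syme : symmetric e) (euv : e u v).

(** The merged vertex keeps the name [u]; the guard [x != y] discards the loop left by [uv]. *)
Definition contract_rel (x y : {x | x != v}) :=
  (x != y) && [|| e (val x) (val y), (val x == u) && e v (val y)
                 | (val y == u) && e (val x) v].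

Lemma clique_minor_contract n :
  rel_clique_minor contract_rel n -> rel_clique_minor e n.
Proof.
pose f (x : {x | x != v}) := [set val x] :|: (if val x == u then [set v] else set0).
have fE x y : (y \in f x) = (y == val x) || (val x == u) && (y == v).
  by rewrite /f !inE; case: ifP => _; rewrite ?inE.
apply: (@clique_minor_lift _ _ _ _ f).
- move=> x; rewrite /f; case: eqP => [->|_]; last first.
    by rewrite setU0; apply: rel_connected1.
  apply/rel_connectedP; split; first by exists u; rewrite !inE eqxx.
  have uv : connect (induced e ([set u] :|: [set v])) u v.
    by apply: connect1; rewrite /induced /= !inE !eqxx orbT.
  have vu : connect (induced e ([set u] :|: [set v])) v u.
    by apply: connect1; rewrite /induced /= !inE !eqxx orbT syme.
  by move=> a b /setUP[]/set1P-> /setUP[]/set1P->.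
- move=> x y xy; apply/pred0P => a; rewrite /= !fE.
  apply/negbTE/negP=> /andP[/orP[/eqP->|/andP[/eqP xu /eqP->]]].
    case/orP=> [/eqP E|/andP[_]]; last by rewrite (negbTE (valP x)).
    by case/negP: xy; apply/eqP/val_inj.
  case/orP=> [E|/andP[/eqP yu _]]; first by rewrite eq_sym (negbTE (valP y)) in E.
  by case/negP: xy; apply/eqP/val_inj; rewrite xu yu.
- move=> x y /andP[_ /or3P[exy|/andP[/eqP xu evy]|/andP[/eqP yu exv]]].
  + by exists (val x), (val y); rewrite !fE !eqxx.
  + by exists v, (val y); rewrite !fE xu !eqxx orbT.
  + by exists (val x), v; rewrite !fE yu !eqxx orbT.
Qed.

Lemma contract_sym : symmetric contract_rel.
Proof.
move=> x y; rewrite /contract_rel eq_sym; congr andb.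
rewrite (syme (val y) (val x)); congr orb.
by rewrite orbC (syme v (val x)) (syme v (val y)).
Qed.

End Contract.

Ltac from_nbrs3 N := let y := fresh in let H := fresh in move=> y H;
  case: (N y H) => ->; by [constructor 1|constructor 2|constructor 3].

Section HighDegree.
Variables (T : finType) (e : rel T) (z : T).
Hypotheses (syme : symmetric e) (irre : irreflexive e).
Hypothesis high : forall x, x != z -> ~ low_degree e x.

Definition nbrs3 x a b c := forall y, e x y -> [\/ y = a, y = b | y = c].

Definition diamond u w a b :=
  [/\ u != z, w != z, e u w, nbrs3 u w a b & nbrs3 w u a b].

Lemma edge_neq x y : e x y -> x != y.
Proof. by apply: contraTneq => ->; rewrite irre. Qed.

(** A missing or repeated neighbour would leave two vertices covering the neighbourhood, against
    [high]. *)
Lemma nbrs3P x a b c : x != z -> nbrs3 x a b c ->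
  [/\ e x a, e x b, e x c & [/\ a != b, a != c & b != c]].
Proof.
move=> xz N.
have H d d' : (forall y, e x y -> y = d \/ y = d') -> False.
  by move=> D; apply: (high xz); exists d, d'.
split.
- apply/negPn/negP => F; apply: (H b c) => y exy.
  by case: (N y exy) => E; subst; auto; rewrite exy in F.
- apply/negPn/negP => F; apply: (H a c) => y exy.
  by case: (N y exy) => E; subst; auto; rewrite exy in F.
- apply/negPn/negP => F; apply: (H a b) => y exy.
  by case: (N y exy) => E; subst; auto; rewrite exy in F.
- by split; apply/eqP => E; subst; [apply: (H b c)|apply: (H c b)|apply: (H a c)] => y /N[]; auto.
Qed.

(* Low degree after contracting uv can only come from a common neighbour of u and
   v that had degree 3, or from u and v sharing their two other neighbours. *)
Lemma contract_low u v (x : {x | x != v}) :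
    u != v -> val x != z -> low_degree (contract_rel e u (v := v)) x ->
  (exists w c, [/\ w != z, e w u, e w v & nbrs3 w u v c]) \/
  (exists a b, nbrs3 u v a b /\ nbrs3 v u a b).
Proof.
move=> uv xz [a [b L]].
have L' y (yv : y != v) : contract_rel e u x (Sub y yv) -> y = val a \/ y = val b.
  by case/L=> <-; [left|right].
have [xu|xu] := eqVneq (val x) u.
  right; exists (val a), (val b); split=> y exy.
    have [->|yv] := eqVneq y v; first by constructor.
    case: (L' y yv) => [|->|->]; [|by constructor 2|by constructor 3].
    by rewrite /contract_rel /= -val_eqE /= xu exy andbT edge_neq.
  have [->|yu] := eqVneq y u; first by constructor.
  have yv : y != v by rewrite eq_sym edge_neq.
  case: (L' y yv) => [|->|->]; [|by constructor 2|by constructor 3].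
  by rewrite /contract_rel /= -val_eqE /= xu eqxx exy orbT andbT eq_sym.
have Lx y : y != v -> e (val x) y -> y = val a \/ y = val b.
  move=> yv exy; apply: (L' y yv).
  by rewrite /contract_rel /= -val_eqE /= exy andbT edge_neq.
have [exv|exv] := boolP (e (val x) v); last first.
  case: (high xz); exists (val a), (val b) => y exy; apply: Lx => //.
  by apply/eqP => yv; case/negP: exv; move: exy; rewrite yv.
left; exists (val x).
have [c N] : exists c, nbrs3 (val x) u v c.
  have [] : u = val a \/ u = val b.
  - by apply: (L' u uv); rewrite /contract_rel /= -val_eqE /= xu eqxx exv !orbT.
  - move=> ua; exists (val b) => y exy; have [->|/Lx/(_ exy)[]->] := eqVneq y v.
    + by constructor 2.
    + by constructor.
    + by constructor 3.
  - move=> ua; exists (val a) => y exy; have [->|/Lx/(_ exy)[]->] := eqVneq y v.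
    + by constructor 2.
    + by constructor 3.
    + by constructor.
by exists c; have [] := nbrs3P xz N.
Qed.

(** Let [w] be a common neighbour of an edge [yv] avoiding [z], with neighbours [y], [v], [x]. The
    common neighbour demanded by the edge [wx] is [y] or [v], and its neighbourhood completes a
    diamond. *)
Lemma diamond_exists :
    (exists y, y != z) ->
    (forall u v, u != z -> v != z -> e u v ->
       (exists w c, [/\ w != z, e w u, e w v & nbrs3 w u v c]) \/
       (exists a b, nbrs3 u v a b /\ nbrs3 v u a b)) ->
  exists u w a b, diamond u w a b.
Proof.
move=> [y yz] step.
have step' u v : u != z -> v != z -> e u v ->
   (exists w c, [/\ w != z, e w u, e w v & nbrs3 w u v c]) \/
   (exists u w a b, diamond u w a b).
  move=> uz vz uv; case: (step u v uz vz uv) => [|[a [b [N1 N2]]]]; first by left.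
  by right; exists u, v, a, b.
have [v vz yv] : exists2 v, v != z & e y v.
  apply: contrapT => F; apply: (high yz); exists z, z => v yv; left.
  by apply/eqP/negPn/negP => vz; apply: F; exists v.
case: (step' y v yz vz yv) => // -[w [x [wz wy wv Nw]]].
have [_ _ wx [_ yx vx]] := nbrs3P wz Nw.
have [xz|xz] := eqVneq x z; last first.
  case: (step' w x wz xz wx) => // -[t [c [tz tw tx Nt]]].
  have [_ _ _ [_ wc xc]] := nbrs3P tz Nt.
  have : t = y \/ t = v.
    have [] := Nw t; [by rewrite syme|by left|by right|move=> E].
    by rewrite E irre in tx.
  case=> E; subst t.
    have E : v = c.
      by case: (Nt v yv) => // E; [rewrite E irre in wv|rewrite E eqxx in vx].
    subst c; exists y, w, v, x; split=> //; from_nbrs3 Nt.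
  have E : y = c.
    case: (Nt y) => // [|E|E]; first by rewrite syme.
      by rewrite E irre in wy.
    by rewrite E eqxx in yx.
  subst c; exists v, w, y, x; split=> //; first [by rewrite syme|from_nbrs3 Nt|from_nbrs3 Nw].
subst x.
case: (step' w y wz yz wy) => // -[t [c [tz tw ty Nt]]].
have E : t = v.
  have [] := Nw t; [by rewrite syme| |by []|by move=> E; rewrite E eqxx in tz].
  by move=> E; rewrite E irre in ty.
subst t.
case: (step' w v wz vz wv) => // -[t [d [tz' tw' tv' Nt']]].
have E : t = y.
  have [] := Nw t; [by rewrite syme|by []| |].
    by move=> E; rewrite E irre in tv'.
  by move=> E; rewrite E eqxx in tz'.
subst t.
have [_ _ yd [_ wd vd]] := nbrs3P yz Nt'.
have [dz|dz] := eqVneq d z.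
  subst d; exists y, w, v, z; split=> //; rewrite syme.
case: (step' y d yz dz yd) => // -[t [f [tz2 ty2 td2 Nt2]]].
have [E|E] : t = w \/ t = v.
  have [] := Nt' t; [by rewrite syme|by left|by right|move=> E].
  by rewrite E irre in td2.
- subst t; case: (Nw d td2) => E; first by rewrite E irre in yd.
    by rewrite E eqxx in vd.
  by rewrite E eqxx in dz.
- subst t; have E : d = c.
    case: (Nt d td2) => // E; first by rewrite E eqxx in wd.
    by rewrite E irre in yd.
  subst c; exists y, v, w, d; split=> //; [from_nbrs3 Nt'|from_nbrs3 Nt].
Qed.

Lemma component_connected (r : rel T) x : symmetric r -> subrel r e ->
  rel_connected e [set y | connect r x y].
Proof.
move=> symr sub; apply/rel_connectedP; split; first by exists x; rewrite inE.
set B := [set _ | _].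
have sB y y' : y \in B -> connect r y y' -> connect (induced e B) y y'.
  move=> yB /connectP[p]; elim: p y yB => [|c p IH] y yB /=; first by move=> _ ->.
  case/andP=> yc pc lc.
  have cB : c \in B by move: yB; rewrite !inE => /connect_trans; apply; apply: connect1.
  apply: connect_trans (IH c cB pc lc); apply: connect1.
  by rewrite /induced /= yB cB sub.
move=> y y' yB y'B; apply: (sB _ _ yB); move: yB y'B; rewrite !inE.
by rewrite (sym_connect_sym symr); apply: connect_trans.
Qed.

Lemma induced_sym (S : {set T}) : symmetric (induced e S).
Proof. by move=> x y; rewrite /induced /= andbCA syme. Qed.

Lemma K4_of_sets (A B C D : {set T}) :
    [/\ rel_connected e A, rel_connected e B, rel_connected e C & rel_connected e D] ->
    (forall X Y, (X, Y) \in [:: (A, B); (A, C); (A, D); (B, C); (B, D); (C, D)] ->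
       [disjoint X & Y] /\ exists x y, [/\ x \in X, y \in Y & e x y]) ->
  rel_clique_minor e 4.
Proof.
move=> [cA cB cC cD] H; pose s := [:: A; B; C; D].
apply/rel_clique_minorP; exists (fun i => nth set0 s i); split.
  by case=> [[|[|[|[|]]]]].
have lt (i j : 'I_4) : i < j -> [disjoint nth set0 s i & nth set0 s j] /\
    exists x y, [/\ x \in nth set0 s i, y \in nth set0 s j & e x y].
  by case: i j => [[|[|[|[|i]]]]] //= Hi [[|[|[|[|j]]]]] //= Hj _; apply: H;
     rewrite !inE !eqxx ?orbT.
move=> i j; rewrite neq_ltn => /orP[/lt //|/lt[dji [x [y [xj yi exy]]]]].
by rewrite disjoint_sym; split=> //; exists y, x; rewrite syme.
Qed.

(** The branch sets are the singletons of [u], [w], [a] and the component [B] of [b] once these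
    three are deleted. *)
Lemma diamond_K4 u w a b : diamond u w a b ->
  connect (induced e (~: [set u; w])) a b -> rel_clique_minor e 4.
Proof.
move=> [uz wz uw Nu Nw] cab.
have [_ ua ub [wa wb ab]] := nbrs3P uz Nu.
have [_ wa' wb' _] := nbrs3P wz Nw.
have ua' := edge_neq ua; have ub' := edge_neq ub; have uw' := edge_neq uw.
pose e1 := induced e (~: [set u; w; a]).
pose B := [set y | connect e1 b y].
have BS y : y \in B -> y \notin [set u; w; a].
  rewrite inE => /connectP[p]; elim/last_ind: p => [_ -> /=|p c _].
    by rewrite !inE !negb_or !(eq_sym b) ub' wb ab.
  by rewrite rcons_path last_rcons => /andP[_ /and3P[_ + _]] ->; rewrite in_setC.
have bB : b \in B by rewrite inE.
apply: (@K4_of_sets [set u] [set w] [set a] B).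
  split; try exact: rel_connected1.
  by apply: component_connected (induced_sym _) _ => x y /and3P[].
(* A path from [b] to [a] avoiding [u] and [w] stays in [B] until it first meets [a]. *)
have [c cB ac] : exists2 c, c \in B & e a c.
  apply: contrapT => F.
  move: cab; rewrite (sym_connect_sym (induced_sym _)) => /connectP[q].
  have H x : x \in B -> path (induced e (~: [set u; w])) x q -> a = last x q -> False;
    last exact: H bB.
  elim: q x => [|c q IH] x xB /=.
    by move=> _ E; have := BS _ xB; rewrite -E !inE eqxx orbT.
  case/andP=> /and3P[_ cS xc] pq lq; apply: (IH c _ pq lq).
  have xc1 : connect e1 x c.
    apply: connect1; rewrite /e1 /induced /= xc andbT; apply/andP; split.
      by rewrite inE; apply: BS.
    move: cS; rewrite !inE !negb_or => ->; apply/eqP => E; subst c.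
    by apply: F; exists x; rewrite // syme.
  by move: xB; rewrite !inE => /connect_trans; apply.
move=> X Y; rewrite !inE.
have D x : x \in [set u; w; a] -> [disjoint [set x] & B].
  by move=> xS; rewrite disjoints1; apply: contraL xS; apply: BS.
case/or4P => [/eqP[-> ->]|/eqP[-> ->]|/eqP[-> ->]|/or3P[] /eqP[-> ->]].
- by rewrite disjoints1 inE; split=> //; exists u, w; rewrite !inE.
- by rewrite disjoints1 inE; split=> //; exists u, a; rewrite !inE.
- by split; [apply: D; rewrite !inE eqxx|exists u, b; rewrite !inE in bB *].
- by rewrite disjoints1 inE; split=> //; exists w, a; rewrite !inE.
- by split; [apply: D; rewrite !inE eqxx orbT|exists w, b; rewrite !inE in bB *].
- by split; [apply: D; rewrite !inE eqxx orbT|exists a, c; rewrite !inE in cB *].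
Qed.

End HighDegree.

(* If a and b are separated by the diamond {u, w}, the induction goes on with the
   side that avoids z, whose attachment vertex becomes the new exception. *)
Lemma high_degree_K4 (T : finType) (e : rel T) (z : T) :
    symmetric e -> irreflexive e ->
    (exists y, y != z) -> (forall x, x != z -> ~ low_degree e x) ->
  rel_clique_minor e 4.
Proof.
have [n] := ubnP #|T|; elim: n T e z => // n IH T e z leTn syme irre ne high.
have IHsub (P : pred T) v : ~~ P v -> forall (e' : rel {x | P x}) z',
    symmetric e' -> irreflexive e' -> (exists y, y != z') ->
    (forall x, x != z' -> ~ low_degree e' x) -> rel_clique_minor e' 4.
  move=> Pv e' z'; apply: IH; exact: leq_trans (card_sub_lt Pv) leTn.
apply: contrapT => noK4.
have [|u [w [a [b D]]]] := diamond_exists syme irre high ne.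
  move=> u v uz vz euv.
  have uv : u != v by apply: edge_neq euv.
  have zv : z != v by rewrite eq_sym.
  have [[x [xz lx]]|nl] := pselect (exists x : {x | x != v},
       val x != z /\ low_degree (contract_rel e u (v := v)) x).
    exact: contract_low xz lx.
  case: noK4; apply: (clique_minor_contract syme euv).
  have vv : ~~ (v != v) by rewrite eqxx.
  apply: (IHsub _ v vv _ (Sub z zv)).
  - exact: contract_sym.
  - by move=> x; rewrite /contract_rel eqxx.
  - by exists (Sub u uv).
  - by move=> x xz lx; apply: nl; exists x.
have [|nab] := boolP (connect (induced e (~: [set u; w])) a b).
  by move/(diamond_K4 syme irre high D).
(* [z] cannot be connected to both [a] and [b], so a swap at most cuts it off from [a']. *)
have {D nab} [a' [b' [D nab za]]] : exists a' b', [/\ diamond e z u w a' b',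
    ~~ connect (induced e (~: [set u; w])) a' b' &
    ~~ connect (induced e (~: [set u; w])) a' z].
  have csym := sym_connect_sym (induced_sym syme (~: [set u; w])).
  have [caz|] := boolP (connect (induced e (~: [set u; w])) a z); last by exists a, b.
  exists b, a; split; last 2 first.
  - by rewrite csym.
  - by apply: contra nab => bz; apply: connect_trans caz _; rewrite csym.
  case: D => uz wz uw Nu Nw; split=> //; [from_nbrs3 Nu|from_nbrs3 Nw].
case: D => uz wz uw Nu Nw.
set r := induced e (~: [set u; w]) in nab za.
have [_ ua ub [wa wb ab]] := nbrs3P high uz Nu.
have az : a' != z by apply: contraNneq za => ->; apply: connect0.
pose P := connect r a'.
have PS x : P x -> x \notin [set u; w].
  move=> /connectP[p]; elim/last_ind: p => [_ -> /=|p c _].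
    by rewrite !inE negb_or !(eq_sym a') wa (edge_neq irre ua).
  by rewrite rcons_path last_rcons => /andP[_ /and3P[_ + _]] ->; rewrite in_setC.
have Pu : ~~ P u by apply/negP => /PS; rewrite !inE eqxx.
(* [u] and [w] attach to the component [P] of [a'] only at [a']: every other vertex of [P] keeps all
   its neighbours there. *)
have Pstep x y : P x -> x != a' -> e x y -> P y.
  move=> Px xa exy; apply: connect_trans (Px) (connect1 _).
  have xS := PS _ Px; rewrite /r /induced /= exy !in_setC xS andbT.
  have xb : x != b' by apply: contraNneq nab => <-.
  apply/negP => /set2P[E|E]; subst y; move: exy; rewrite syme.
  - by case/Nu=> E; [rewrite E !inE eqxx orbT in xS|rewrite E eqxx in xa|rewrite E eqxx in xb].
  - by case/Nw=> E; [rewrite E !inE eqxx in xS|rewrite E eqxx in xa|rewrite E eqxx in xb].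
have Pa : P a' by apply: connect0.
apply: noK4; apply: (@clique_minor_sub _ _ P).
apply: (IHsub _ u Pu _ (Sub a' Pa)).
- by move=> x y; apply: syme.
- by move=> x; apply: irre.
- have [y ey yuw] : exists2 y, e a' y & y \notin [set u; w].
    apply: contrapT => F; apply: (high _ az); exists u, w => y ey.
    by apply/set2P/negPn/negP => yuw; apply: F; exists y.
  have Py : P y.
    apply: connect1; rewrite /r /induced /= ey !in_setC yuw !andbT.
    exact: PS.
  exists (Sub y Py); rewrite -val_eqE /= eq_sym; exact: edge_neq ey.
- move=> x xa [c [d L]]; apply: (high (val x)).
    by apply: contraNneq za => <-; have := valP x.
  exists (val c), (val d) => y exy.
  have Py : P y by apply: (Pstep (val x)); [apply: (valP x)|rewrite -val_eqE in xa|].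
  by case: (L (Sub y Py) exy) => <-; [left|right].
Qed.

Lemma low_degree_exists (T : finType) (e : rel T) (z : T) :
  symmetric e -> irreflexive e -> ~~ rel_clique_minor e 4 ->
  exists x, low_degree e x.
Proof.
move=> syme irre noK4.
have [[y yz]|all_z] := pselect (exists y, y != z).
  apply: contrapT => F; case/negP: noK4.
  apply: (high_degree_K4 syme irre); first by exists y; exact: yz.
  by move=> x _ lx; apply: F; exists x.
exists z, z, z => y _; left; apply/eqP/negPn/negP => yz; apply: all_z.
by exists y.
Qed.

(** * Prescribed Hamming distances *)

Definition hamming k (A B : {set 'I_k}) := #|[set i | (i \in A) (+) (i \in B)]|.

Lemma hammingC k (A B : {set 'I_k}) : hamming A B = hamming B A.
Proof. by congr #|pred_of_set _|; apply/setP => i; rewrite !inE addbC. Qed.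

Lemma hammingxx k (A : {set 'I_k}) : hamming A A = 0.
Proof. by apply: eq_card0 => i; rewrite !inE addbb. Qed.

Lemma subset_of_card (T : finType) (A : {set T}) n : n <= #|A| ->
  exists2 B : {set T}, B \subset A & #|B| = n.
Proof.
move=> nA; exists [set x in take n (enum A)].
  by apply/subsetP => x; rewrite inE => /mem_take; rewrite mem_enum.
rewrite cardsE (card_uniqP _) ?take_uniq ?enum_uniq // size_takel //.
by rewrite -cardE.
Qed.

(** With d the distance from [X] to [Y], flip in [X] p = (s + d - t)/2 coordinates where they differ
    and q = (s + t - d)/2 where they agree: then p + q = s and d - p + q = t. The inequalities and
    the parity make p and q admissible. *)
Lemma hamming_fill k (X Y : {set 'I_k}) s t :
    s <= hamming X Y + t -> t <= hamming X Y + s -> hamming X Y <= s + t ->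
    hamming X Y + s + t <= k.*2 -> ~~ odd (hamming X Y + s + t) ->
  exists Z, hamming Z X = s /\ hamming Z Y = t.
Proof.
set D := [set i | (i \in X) (+) (i \in Y)]; have -> : hamming X Y = #|D| by [].
move=> H1 H2 H3 H4 H5.
have DC : #|D| + #|~: D| = k by rewrite cardsC card_ord.
have [|P PD cP] := @subset_of_card _ D ((s + #|D| - t)./2); first by lia.
have [|Q QD cQ] := @subset_of_card _ (~: D) ((s + t - #|D|)./2); first by lia.
have dPQ : [disjoint P & Q].
  by rewrite disjoints_subset (subset_trans PD) // -setCS setCK.
have dPQ' : [disjoint D :\: P & Q].
  by rewrite disjoints_subset (subset_trans (subsetDl _ _)) // -setCS setCK.
exists [set i | (i \in X) (+) (i \in P :|: Q)]; split.
  rewrite (_ : hamming _ _ = #|P :|: Q|); last first.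
    by apply: eq_card => i; rewrite inE [in X in X (+) _]inE addbAC addbb.
  by rewrite cardsU disjoint_setI0 // cards0; lia.
rewrite (_ : hamming _ _ = #|(D :\: P) :|: Q|); last first.
  apply: eq_card => i; rewrite !inE.
  have /implyP := subsetP PD i; have /implyP := subsetP QD i; rewrite !inE.
  by do 4!case: (_ \in _).
rewrite cardsU disjoint_setI0 // cards0 cardsD (setIidPr PD); lia.
Qed.

Lemma hamming_labelling (T : finType) (e : rel T) k (t : T -> T -> nat) :
    symmetric e -> irreflexive e -> ~~ rel_clique_minor e 4 ->
    (forall x y, t x y = t y x) ->
    (forall x y, x != y -> t x y <= k) ->
    (forall x y z, x != y -> y != z -> x != z ->
      [/\ t x z <= t x y + t y z, t x y + t y z + t x z <= k.*2
        & ~~ odd (t x y + t y z + t x z)]) ->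
  exists F : T -> {set 'I_k}, forall x y, e x y -> hamming (F x) (F y) = t x y.
Proof.
have [n] := ubnP #|T|; elim: n T e t => // n IH T e t leTn syme irre noK4 tC tk tri.
have [w0|noz] := pselect (exists z : T, true); last first.
  by exists (fun=> set0) => x; case: noz; exists x.
have [v lv] : exists v, low_degree e v.
  by case: w0 => z _; apply: low_degree_exists z _ _ _.
have nev x y : e x y -> x != y by apply: contraTneq => ->; rewrite irre.
suff [F [Z [FE ZE]]] : exists (F : T -> {set 'I_k}) Z,
    (forall x y, x != v -> y != v -> e x y -> hamming (F x) (F y) = t x y) /\
    (forall y, e v y -> hamming Z (F y) = t v y).
  exists (fun x => if x == v then Z else F x) => x y exy.
  have [xv|xv] := eqVneq x v; have [yv|yv] := eqVneq y v.
  - by subst; rewrite irre in exy.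
  - by subst; apply: ZE.
  - by subst; rewrite hammingC tC ZE // syme.
  - exact: FE.
have IHsub (e' : rel {x | x != v}) : symmetric e' -> irreflexive e' ->
    ~~ rel_clique_minor e' 4 -> exists F : T -> {set 'I_k},
    forall x y, e' x y -> hamming (F (val x)) (F (val y)) = t (val x) (val y).
  move=> syme' irre' noK4'.
  have vv : ~~ (v != v) by rewrite eqxx.
  have [||x y|x y z xy yz xz|F FE] := IH _ e' (fun x y => t (val x) (val y)) _ syme' irre' noK4'.
  - exact: leq_trans (@card_sub_lt _ [pred x | x != v] v vv) leTn.
  - by move=> x y; apply: tC.
  - by move=> xy; apply: tk.
  - by apply: tri.
  - exists (fun x => if insub x is Some x' then F x' else set0) => x y exy.
    by rewrite !valK; apply: FE.
have [[a Na]|N1] := pselect (exists a, forall y, e v y -> y = a).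
  have [|||F FE] := IHsub (fun x y => e (val x) (val y)).
  - by move=> x y; apply: syme.
  - by move=> x; apply: irre.
  - by apply: contra noK4; apply: clique_minor_sub.
  have FE' x y : x != v -> y != v -> e x y -> hamming (F x) (F y) = t x y.
    by move=> xv yv exy; apply: (FE (Sub x xv) (Sub y yv)).
  have [va|va] := boolP (e v a).
    have := tk v a (nev _ _ va) => tk'.
    have [|||||Z [ZE _]] := @hamming_fill k (F a) (F a) (t v a) (t v a);
      rewrite ?hammingxx; try lia.
    by exists F, Z; split=> // y /Na->.
  by exists F, set0; split=> // y vy; move: (vy); rewrite (Na _ vy) (negbTE va).
have [a [b [va vb ab Nab]]] : exists a b, [/\ e v a, e v b, a != b &
    forall y, e v y -> y = a \/ y = b].
  case: lv => a [b Nab]; exists a, b; split=> //.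
  - apply/negPn/negP => va; apply: N1; exists b => y vy.
    by case: (Nab y vy) => // E; subst; rewrite vy in va.
  - apply/negPn/negP => va; apply: N1; exists a => y vy.
    by case: (Nab y vy) => // E; subst; rewrite vy in va.
  - by apply/eqP => E; apply: N1; exists a => y /Nab[]; rewrite ?E.
have av : e a v by rewrite syme.
(* Contracting [v] into [a], rather than deleting it, makes [a] and [b] adjacent, so the recursive
   labelling already realizes [t a b]. *)
have [|||F FE] := IHsub (contract_rel e a (v := v)).
- exact: contract_sym.
- by move=> x; rewrite /contract_rel eqxx.
- by apply: contra noK4; apply: clique_minor_contract.
have neav := nev _ _ va; have nebv := nev _ _ vb.
have FE' x y : x != v -> y != v -> e x y -> hamming (F x) (F y) = t x y.
  move=> xv yv exy; apply: (FE (Sub x xv) (Sub y yv)).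
  by rewrite /contract_rel -val_eqE /= exy nev.
have Fab : hamming (F a) (F b) = t a b.
  rewrite eq_sym in neav; rewrite eq_sym in nebv.
  apply: (FE (Sub a neav) (Sub b nebv)).
  by rewrite /contract_rel -val_eqE /= eqxx vb ab !orbT.
have bv : b != v by rewrite eq_sym.
have [T1 T2 T3] := tri v a b neav ab nebv.
have [T4 _ _] := tri a v b ltac:(by rewrite eq_sym) nebv ab.
have [T5 _ _] := tri v b a nebv ltac:(by rewrite eq_sym) neav.
rewrite (tC a v) (tC b a) in T4 T5.
have [|||||Z [ZA ZB]] := @hamming_fill k (F a) (F b) (t v a) (t v b);
  rewrite ?Fab; try lia.
by exists F, Z; split=> // y /Nab[]->.
Qed.

(** * Target distances from signed walks *)

Section Weight.
Variables (k : nat) (pos neg : nat -> Prop).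

(* [pos] and [neg] are the lengths of positive and negative walks between two
   given vertices.  The last two clauses say that [t] leaves the vicinity of k/2
   only when a walk bound is attained. *)
Definition weight_spec t :=
  [/\ t <= k, forall n, pos n -> t <= n /\ odd n = odd t,
      forall n, neg n -> k <= t + n /\ odd (n + t) = odd k,
      t.*2 + 2 < k -> pos t & k + 1 < t.*2 -> neg (k - t)].

Lemma weight_exists :
    1 < k ->
    (forall n m, pos n -> pos m -> odd n = odd m) ->
    (forall n m, neg n -> neg m -> odd n = odd m) ->
    (forall n m, pos n -> neg m -> k <= n + m /\ odd (n + m) = odd k) ->
    (exists n, pos n \/ neg n) ->
  exists t, weight_spec t.
Proof.
move=> k1 pp nn pn [n0 n0P].
have [b [bp bn]] : exists b, (forall n, pos n -> odd n = b) /\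
    (forall n, neg n -> odd n = b (+) odd k).
  case: n0P => n0P.
    exists (odd n0); split=> [n|n] nP; first exact: pp.
    by have [_] := pn _ _ n0P nP; rewrite oddD => <-; rewrite addbA addbb.
  exists (odd n0 (+) odd k); split=> [n nP|n nP].
    by have [_] := pn _ _ nP n0P; rewrite oddD => <-; rewrite addbCA addbb addbF.
  by rewrite (nn _ _ nP n0P) -addbA addbb addbF.
pose h := k./2.
(* [m] is a number of the forced parity [b] nearest to k/2. Since k - 2 <= 2m <= k + 1, the choice
   [t = m] makes the last two clauses of [weight_spec] vacuous. *)
pose m := if odd h == b then h else if odd k then h.+1 else h.-1.
have mb : odd m = b by rewrite /m; case: eqP => // /eqP; case: ifP; rewrite /h; lia.
have mk1 : m.*2 <= k + 1 by rewrite /m /h; do !case: ifP; lia.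
have mk2 : k <= m.*2 + 2 by rewrite /m /h; do !case: ifP; lia.
have mk : m <= k by rewrite /m /h; do !case: ifP; lia.
have least (P : nat -> Prop) : (exists n, P n) -> exists2 n, P n & forall n', P n' -> n <= n'.
  move=> exP; have exP' : exists n, `[< P n >] by case: exP => n /asboolP; exists n.
  case: (ex_minnP exP') => n /asboolP Pn min; exists n => // n' /asboolP; exact: min.
(* A positive walk shorter than [m], or a negative one shorter than [k - m], overrides that choice:
   a shortest one fixes [t], and [pn] gives the bound for the other sign. *)
have [exp|nop] := pselect (exists n, pos n /\ n < m).
  have [n [Pn nm] min] := least _ exp.
  have min' n' : pos n' -> n <= n'.
    by move=> Pn'; case: (leqP m n') => [|nm']; [lia|apply: min].
  exists n; split=> [|n' Pn'|n' Nn'|_|]; try lia.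
  - by rewrite (bp _ Pn) (bp _ Pn') min'.
  - by have [] := pn _ _ Pn Nn'; rewrite addnC.
  - exact: Pn.
have [exn|non] := pselect (exists n, neg n /\ n + m < k).
  have [n [Nn nm] min] := least _ exn.
  have min' n' : neg n' -> n <= n'.
    by move=> Nn'; case: (leqP k (n' + m)) => [|nm']; [lia|apply: min].
  have onk := bn _ Nn.
  exists (k - n); split=> [|n' Pn'|n' Nn'||_]; try lia.
  - by have [? ?] := pn _ _ Pn' Nn; lia.
  - by have := min' _ Nn'; have := bn _ Nn'; lia.
  - by rewrite subKn //; lia.
exists m; split=> // [n Pn|n Nn||]; try lia.
- rewrite (bp _ Pn) mb; split=> //; rewrite leqNgt; apply/negP => nm.
  by apply: nop; exists n.
- have := bn _ Nn; split; last by lia.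
  by rewrite leqNgt; apply/negP => nm; apply: non; exists n; split=> //; lia.
Qed.

End Weight.

Section SignedMetric.
Variables (T : Type) (W : bool -> T -> T -> nat -> Prop) (k : nat).
Hypothesis k_gt1 : 1 < k.
Hypothesis Wsym : forall i x y n, W i x y n -> W i y x n.
Hypothesis Wcat : forall i j x y z n m,
  W i x y n -> W j y z m -> W (i (+) j) x z (n + m).
Hypothesis W0 : forall i x y, W i x y 0 -> x = y.
Hypothesis Wex : forall x y, exists i n, W i x y n.
Hypothesis Wclosed : forall i x n,
  W i x x n -> if i then k <= n /\ odd n = odd k else ~~ odd n.

Let spec x y := weight_spec k (W false x y) (W true x y).

Lemma metric_weight_exists x y : exists t, spec x y t.
Proof.
apply: weight_exists => //.
- move=> n m Pn /Wsym Pm; have := Wclosed (Wcat Pn Pm); rewrite oddD /=.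
  by do 2!case: odd.
- move=> n m Pn /Wsym Pm; have := Wclosed (Wcat Pn Pm); rewrite oddD /=.
  by do 2!case: odd.
- by move=> n m Pn /Wsym Pm; apply: (Wclosed (Wcat Pn Pm)).
- by have [[] [n Wn]] := Wex x y; exists n; [right|left].
Qed.

Lemma spec_sym x y t : spec x y t -> spec y x t.
Proof.
case=> ? P N S L; split=> //.
- by move=> n /Wsym/P.
- by move=> n /Wsym/N.
- by move/S/Wsym.
- by move/L/Wsym.
Qed.

Lemma spec_parity x y z t1 t2 t3 : spec x y t1 -> spec y z t2 -> spec x z t3 ->
  ~~ odd (t1 + t2 + t3).
Proof.
move=> [? P1 N1 _ _] [? P2 N2 _ _] [? P3 N3 _ _].
have [i [n Wn]] := Wex x y; have [j [m Wm]] := Wex y z.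
have := Wcat Wn Wm; case: i Wn => Wn; case: j Wm => Wm /= W3.
- by have [_ ?] := N1 _ Wn; have [_ ?] := N2 _ Wm; have [_ ?] := P3 _ W3; lia.
- by have [_ ?] := N1 _ Wn; have [_ ?] := P2 _ Wm; have [_ ?] := N3 _ W3; lia.
- by have [_ ?] := P1 _ Wn; have [_ ?] := N2 _ Wm; have [_ ?] := N3 _ W3; lia.
- by have [_ ?] := P1 _ Wn; have [_ ?] := P2 _ Wm; have [_ ?] := P3 _ W3; lia.
Qed.

(** A small weight is the length of a positive walk, a large one is [k] minus the length of a
    negative walk. Two such walks concatenate into one against the bound for the third weight; the
    remaining cases are arithmetic. *)
Lemma spec_triangle x y z t1 t2 t3 : x <> z ->
  spec x y t1 -> spec y z t2 -> spec x z t3 -> t3 <= t1 + t2.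
Proof.
move=> xz s1 s2 s3; have par := spec_parity s1 s2 s3.
case: s1 s2 s3 => [k1 P1 N1 S1 L1] [k2 P2 N2 S2 L2] [k3 P3 N3 S3 L3].
rewrite leqNgt; apply/negP => lt3.
(* When neither [t1] nor [t2] is small, only [t3 = k] is left; a negative walk of length 0 would
   then give [x = z]. *)
have t3k : t3 = k -> False.
  by move=> E; apply: xz; apply: (@W0 true); rewrite -(subnn k) -{2}E; apply: L3; lia.
have [l1|g1] := ltnP (t1.*2 + 2) k.
  have W1 := S1 l1; have [l2|g2] := ltnP (t2.*2 + 2) k.
    by have [] := P3 _ (Wcat W1 (S2 l2)); lia.
  have [l3|g3] := ltnP (k + 1) t3.*2; last lia.
  by have [] := N2 _ (Wcat (Wsym W1) (L3 l3)); lia.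
have [l2|g2] := ltnP (t2.*2 + 2) k; last lia.
have [l3|g3] := ltnP (k + 1) t3.*2; last lia.
by have [] := N1 _ (Wcat (L3 l3) (Wsym (S2 l2))); lia.
Qed.

(** An excessive perimeter forces two large weights; their negative walks concatenate into a
    positive walk shorter than the third weight. *)
Lemma spec_perimeter x y z t1 t2 t3 :
  spec x y t1 -> spec y z t2 -> spec x z t3 -> t1 + t2 + t3 <= k.*2.
Proof.
move=> s1 s2 s3; have par := spec_parity s1 s2 s3.
case: s1 s2 s3 => [k1 P1 N1 S1 L1] [k2 P2 N2 S2 L2] [k3 P3 N3 S3 L3].
rewrite leqNgt; apply/negP => lt3.
have [l1|g1] := ltnP (k + 1) t1.*2.
  have W1 := L1 l1; have [l2|g2] := ltnP (k + 1) t2.*2.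
    by have [] := P3 _ (Wcat W1 (L2 l2)); lia.
  have [l3|g3] := ltnP (k + 1) t3.*2; last lia.
  by have [] := P2 _ (Wcat (Wsym W1) (L3 l3)); lia.
have [l2|g2] := ltnP (k + 1) t2.*2; last lia.
have [l3|g3] := ltnP (k + 1) t3.*2; last lia.
by have [] := P1 _ (Wcat (L3 l3) (Wsym (L2 l2))); lia.
Qed.

Lemma metric_weights : exists t : T -> T -> nat,
  [/\ forall x y, weight_spec k (W false x y) (W true x y) (t x y),
      forall x y, t x y = t y x
    & forall x y z, x <> z ->
      [/\ t x z <= t x y + t y z, t x y + t y z + t x z <= k.*2
        & ~~ odd (t x y + t y z + t x z)]].
Proof.
have ex x y : exists t, `[< spec x y t >].
  by have [t st] := metric_weight_exists x y; exists t; apply/asboolP.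
have st x y : spec x y (ex_minn (ex x y)) by case: ex_minnP => t /asboolP.
exists (fun x y => ex_minn (ex x y)); split=> // [x y|x y z xz].
  by apply: eq_ex_minn => t; apply: asbool_equiv_eq; split; apply: spec_sym.
split; [exact: (@spec_triangle x y z)|exact: (@spec_perimeter x y z)|exact: (@spec_parity x y z)].
Qed.

End SignedMetric.

(** * Signed projective cubes *)

Section Walks.
Variable G : sgraph.
Implicit Types (x y z : vertex G) (e : edge G) (p q : seq (edge G * vertex G)).

Lemma joinsC e x y : joins e x y = joins e y x.
Proof. by rewrite /joins orbC. Qed.

Lemma adjacentC : symmetric (@adjacent G).
Proof. by move=> x y; apply: eq_existsb => e; apply: joinsC. Qed.

Lemma simple_joins_neq e x y : simple G -> joins e x y -> x != y.
Proof.
move=> /andP[/forallP/(_ e) ne _] /orP[] /eqP E; rewrite E //= in ne.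
by rewrite eq_sym.
Qed.

Lemma simple_adjacent_irr : simple G -> irreflexive (@adjacent G).
Proof.
move=> sG x; apply/negbTE/negP => /existsP[e /(simple_joins_neq sG)].
by rewrite eqxx.
Qed.

Lemma cut_joins (S : {set vertex G}) e x y :
  joins e x y -> cut S e = (x \in S) (+) (y \in S).
Proof. by rewrite /cut => /orP[]/eqP-> //=; rewrite addbC. Qed.

Lemma walk_sign_cons a p : walk_sign (a :: p) = sign a.1 (+) walk_sign p.
Proof. by rewrite /walk_sign big_cons. Qed.

Lemma walk_sign_nil : @walk_sign G [::] = false.
Proof. by rewrite /walk_sign big_nil. Qed.

Lemma walk_sign_cat p q : walk_sign (p ++ q) = walk_sign p (+) walk_sign q.
Proof. by rewrite /walk_sign big_cat. Qed.

Lemma walk_cat x y z p q : walk x p y -> walk y q z -> walk x (p ++ q) z.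
Proof.
elim: p x => [|[e w] p IH] x /=; first by move/eqP->.
by case/andP=> -> /IH H /H.
Qed.

Definition signed_walk (i : bool) x y n :=
  exists p, [/\ walk x p y, walk_sign p = i & size p = n].

Lemma signed_walk0 i x y : signed_walk i x y 0 -> x = y.
Proof. by case=> p [+ _ /size0nil E]; rewrite E => /eqP. Qed.

Lemma signed_walk_cat i j x y z n m :
  signed_walk i x y n -> signed_walk j y z m -> signed_walk (i (+) j) x z (n + m).
Proof.
move=> [p [wp <- <-]] [q [wq <- <-]]; exists (p ++ q).
by rewrite (walk_cat wp wq) walk_sign_cat size_cat.
Qed.

Lemma signed_walk_edge e x y : joins e x y -> signed_walk (sign e) x y 1.
Proof.
by exists [:: (e, y)]; rewrite /= eqxx andbT walk_sign_cons walk_sign_nil addbF.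
Qed.

Lemma signed_walk_sym i x y n : signed_walk i x y n -> signed_walk i y x n.
Proof.
case=> p [wp <- <-] {i n}; elim: p x wp => [|[e z] p IH] x /=.
  by move/eqP->; exists [::]; rewrite /= eqxx.
case/andP=> exz /IH yz; rewrite joinsC in exz.
rewrite walk_sign_cons addbC /= -addn1.
exact: signed_walk_cat yz (signed_walk_edge exz).
Qed.

Lemma signed_walk_exists x y : connected G -> exists i n, signed_walk i x y n.
Proof.
case/rel_connectedP => _ /(_ x y (in_setT _) (in_setT _)) /connectP[p].
elim: p x => [|z p IH] x /=.
  by move=> _ ->; exists false, 0, [::]; rewrite /= eqxx walk_sign_nil.
case/andP=> /and3P[_ _ /existsP[e exz]] pz lz.
have [i [n W]] := IH z pz lz.
by exists (sign e (+) i), (1 + n); apply: signed_walk_cat W; apply: signed_walk_edge.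
Qed.

Lemma closed_walk_lengthP i j n :
  reflect (exists2 x, signed_walk i x x n & odd n = j) (closed_walk_length G i j n).
Proof.
apply: (iffP existsP) => [[x /existsP[p /and3P[wp /eqP si /eqP]]]|[x [p [wp si sz]] on]].
  by exists x => //; exists p; rewrite size_tuple.
exists x; apply/existsP; exists (tcast sz (in_tuple p)); apply/and3P.
by rewrite val_tcast; split=> //; apply/eqP.
Qed.

End Walks.

Lemma girth_geP (G H : sgraph) : girth_ge G H <-> forall i j n,
  closed_walk_length G i j n -> exists2 m, m <= n & closed_walk_length H i j m.
Proof.
split=> [GH i j n cn|GH i j].
  have := GH i j; rewrite /girth; case: pselect => [exH|nexH]; case: pselect => [exG|[]] //=.
  - case: ex_minnP => m cm _; case: ex_minnP => n' _ /(_ n cn) nn mn.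
    by exists m => //; apply: leq_trans nn.
  - by exists n.
  - by exists n.
rewrite /girth; case: (pselect (exists n, closed_walk_length G i j n)) => [exG|nexG] /=;
  last by case: pselect.
case: pselect => [exH|[]] /=; last first.
  by case: exG => n /GH[m _ cm]; exists m.
case: ex_minnP => m _ minm; case: ex_minnP => n /GH[m' m'n /minm mm'] _.
exact: leq_trans m'n.
Qed.

(** The weights are taken for [g.+1]. The labelling in dimension [g.+1] is then folded to dimension
    [g]. *)
Lemma cube_map (G : sgraph) g : 0 < g -> SP G ->
    (forall i j n, closed_walk_length G i j n ->
       if i then g < n /\ j = odd g.+1 else j = false) ->
  exists (S : {set vertex G}) (F : vertex G -> 'I_g -> bool),
    forall e x y, joins e x y ->
      if switch S (@sign G) e then forall i, F x i (+) F y i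
      else exists c, forall i, F x i (+) F y i = (i == c).
Proof.
move=> g0 /and3P[sG cG noK4] Gcl.
have [|||||i x n W|t [tspec tC tri]] := @metric_weights (vertex G) (@signed_walk G) g.+1.
- by [].
- exact: signed_walk_sym.
- exact: signed_walk_cat.
- exact: signed_walk0.
- by move=> x y; apply: signed_walk_exists.
- have /Gcl : closed_walk_length G i (odd n) n by apply/closed_walk_lengthP; exists x.
  by case: i W => _ => [|->].
have [|x y xy|x y z xy yz xz|F FE] :=
  @hamming_labelling _ (@adjacent G) g.+1 t (@adjacentC G) (simple_adjacent_irr sG) noK4.
- exact: tC.
- by have [] := tspec x y.
- by apply: tri; apply/eqP.
(* Bound and parity give a positive edge weight 1 and a negative edge weight [g], hence all
   coordinates but one. *)
have Fe e x y : joins e x y -> exists c, forall i,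
    (i \in F x) (+) (i \in F y) = (i == c) (+) sign e.
  move=> exy; have := FE x y; have -> : adjacent x y by apply/existsP; exists e.
  move/(_ isT); have [tg tp tn _ _] := tspec x y.
  have := signed_walk_edge exy; case: (sign e) => [/tn|/tp] [? ?] ht.
  - have {ht} : #|~: [set i | (i \in F x) (+) (i \in F y)]| = 1.
      have := cardsC [set i | (i \in F x) (+) (i \in F y)].
      rewrite card_ord -[#|[set _ | _]|]/(hamming (F x) (F y)) ht; lia.
    move/eqP/cards1P => [c cE]; exists c => i; have := in_set1 i c.
    by rewrite -cE !inE => <-; rewrite addbT negbK.
  - have {ht} : #|[set i | (i \in F x) (+) (i \in F y)]| = 1.
      rewrite -[#|[set _ | _]|]/(hamming (F x) (F y)) ht; lia.
    move/eqP/cards1P => [c cE]; exists c => i; have := in_set1 i c.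
    by rewrite -cE !inE => <-; rewrite addbF.
(* Switching by coordinate 0 makes exactly the edges flipping it negative; adding
   it to every other coordinate turns those edges into full complements. *)
exists [set x | ord0 \in F x], (fun x i => (lift ord0 i \in F x) (+) (ord0 \in F x)).
move=> e x y exy; have [c cE] := Fe e x y exy.
have E i : ((lift ord0 i \in F x) (+) (ord0 \in F x)) (+)
    ((lift ord0 i \in F y) (+) (ord0 \in F y))
    = (lift ord0 i == c) (+) (ord0 == c).
  by rewrite addbACA !cE addbACA addbb addbF.
rewrite /switch (cut_joins _ exy) !inE cE addbC -addbA addbb addbF.
case: (unliftP ord0 c) E => [c' ->|->] E.
  rewrite (negbTE (neq_lift _ _)); exists c' => i.
  by rewrite E (inj_eq lift_inj) (negbTE (neq_lift _ _)) addbF.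
by rewrite eqxx => i; rewrite E eqxx eq_sym (negbTE (neq_lift _ _)).
Qed.

(** [l] lists the coordinate singled out by each step. *)
Lemma cube_walk (H : sgraph) n (F : vertex H -> 'I_n -> bool) x y p :
    (forall e x y, joins e x y ->
       exists c, forall i, F x i (+) F y i = (i == c) (+) sign e) ->
  walk x p y -> exists l : seq 'I_n, size l = size p /\
    forall c, F x c (+) F y c = odd (count_mem c l) (+) walk_sign p.
Proof.
move=> FE; elim: p x => [|[e z] p IH] x /=.
  by move/eqP->; exists [::]; split=> // c; rewrite walk_sign_nil addbb.
case/andP=> /FE[c cE] /IH[l [sl lE]]; exists (c :: l); split; first by rewrite /= sl.
move=> d; rewrite walk_sign_cons /= oddD oddb eq_sym addbACA -cE -lE.
by rewrite addbA addbK.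
Qed.

(** Around a closed walk each coordinate returns to its value, so it is singled out an odd number of
    times if the walk is negative and an even number otherwise. Summing over the [n] coordinates
    gives the length. *)
Lemma cube_closed_walk (H : sgraph) n (F : vertex H -> 'I_n -> bool) :
    (forall e x y, joins e x y ->
       exists c, forall i, F x i (+) F y i = (i == c) (+) sign e) ->
  forall i j m, closed_walk_length H i j m ->
    if i then n <= m /\ j = odd n else j = false.
Proof.
move=> FE i j m /closed_walk_lengthP[x [p [wp si sz]] <-].
suff [l [sl lE]] : exists l : seq 'I_n, size l = size p /\
    forall c, F x c (+) F x c = odd (count_mem c l) (+) walk_sign p.
  have {}lE c : odd (count_mem c l) = i.
    by have := lE c; rewrite addbb si; case: i {si} => /=; case: odd.
  have -> : odd m = odd n && i.
    rewrite -sz -sl -sum1_size (partition_big id xpredT) //=.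
    rewrite (eq_bigr (fun c => count_mem c l)); last first.
      by move=> c _; rewrite -sum1_count.
    rewrite (big_morph odd oddD (erefl _)) (eq_bigr (fun=> i)) //.
    rewrite big_const card_ord; elim: (n) => //= k ->.
    by case: i {si lE}; rewrite ?andbT ?andbF.
  case: i {si} lE => lE; rewrite ?andbF ?andbT //; split=> //.
  rewrite -[n]card_ord cardE -sz -sl; apply: uniq_leq_size (enum_uniq _) _ => c _.
  by rewrite -has_pred1 has_count; case: (count_mem c l) (lE c).
exact: cube_walk wp.
Qed.

(** The cycle embeds in the cube: vertex [x > 0] gets the coordinates 1 to x - 1 and vertex 0 gets 1
    to g - 1. Edge [e > 0] flips coordinate [e]; the negative edge 0 flips all coordinates but 0. *)
Lemma neg_cycle_closed_walk g i j m : closed_walk_length (neg_cycle g) i j m ->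
  if i then g <= m /\ j = odd g else j = false.
Proof.
apply: (@cube_closed_walk (neg_cycle g) g
  (fun x c => (0 < c) && ((val x == 0) || (c < x)))) => e x y exy.
exists e => c.
suff H : forall x y, ends e = (x, y) ->
   ((0 < c) && ((val x == 0) || (c < x))) (+) ((0 < c) && ((val y == 0) || (c < y)))
     = (c == e) (+) sign e.
  by case/orP: exy => /eqP/H; rewrite // addbC.
move=> {exy}x {}y [<- <-] /=; rewrite -val_eqE /=.
have lt_c := ltn_ord c; have lt_e := ltn_ord e.
have [lt_eg|ge_eg] := ltnP e.+1 g.
  by rewrite modn_small //; lia.
have -> : (e.+1 = g)%N by lia.
by rewrite modnn; lia.
Qed.

(** * Extended double covers *)

Section ExtendedDoubleCover.
Variable B : sgraph.

Lemma EDC_joins_inl v x y : @joins (EDC B) (inl v) x y -> x.1 = y.1 /\ x.2 != y.2.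
Proof. by case: x y => [x a] [y b] /orP[] /eqP[-> <- -> <-]. Qed.

Lemma EDC_joins_inr f b x y : @joins (EDC B) (inr (f, b)) x y ->
  joins f x.1 y.1 /\ sign f = x.2 (+) y.2.
Proof.
case: x y => [x a] [y c] /=; rewrite /joins /=.
by case: (ends f) => u v /orP[] /eqP[-> <- -> <-];
  rewrite eqxx ?orbT; split=> //; case: b; case: sign.
Qed.

(** Project to [B], dropping the edges [inl]. Their number has the parity of [i], and every other
    change of layer is a negative edge of [B]. *)
Lemma EDC_signed_walk i x y n : @signed_walk (EDC B) i x y n ->
  exists m, [/\ @signed_walk B (x.2 (+) y.2 (+) i) x.1 y.1 m, m + i <= n
              & odd m = odd n (+) i].
Proof.
case=> p [wp <- <-] {i n}; elim: p x wp => [|[e z] p IH] x /=.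
  move/eqP->; exists 0; rewrite walk_sign_nil addbb; split=> //.
  by exists [::]; rewrite /= eqxx walk_sign_nil.
case/andP=> exz /IH[m [wm lem om]]; rewrite walk_sign_cons /=.
case: e exz => [v /EDC_joins_inl[-> ne]|[f b] /EDC_joins_inr[fxz sf]] /=.
  exists m; split; last 2 first.
  - by case: walk_sign lem => /=; lia.
  - by rewrite om /=; case: odd; case: walk_sign.
  suff -> : x.2 (+) y.2 (+) ~~ walk_sign p = z.2 (+) y.2 (+) walk_sign p by [].
  by move: ne; case: x.2; case: z.2; case: y.2; case: walk_sign.
exists (1 + m); split; last 2 first.
- by rewrite -addnA.
- by rewrite /= om addNb.
have := signed_walk_cat (signed_walk_edge fxz) wm.
suff -> : sign f (+) (z.2 (+) y.2 (+) walk_sign p) = x.2 (+) y.2 (+) walk_sign p by [].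
by rewrite sf -!addbA; congr addb; rewrite addKb.
Qed.

Lemma EDC_closed_walk i j n : closed_walk_length (EDC B) i j n ->
  exists2 m, m + i <= n & closed_walk_length B i (i (+) j) m.
Proof.
case/closed_walk_lengthP=> x /EDC_signed_walk[m [wm lem om]] <-.
exists m => //; apply/closed_walk_lengthP; exists x.1.
  by rewrite addbb in wm.
by rewrite om addbC.
Qed.

(** [h] is the projection to [B] and [s] the layer; edges negative after switching by [S] go to the
    edges [inl]. *)
Lemma homomorphic_EDC (G : sgraph) (S : {set vertex G}) (h : vertex G -> vertex B)
    (s : vertex G -> bool) :
    (forall e x y, joins e x y ->
       if switch S (@sign G) e then h x = h y /\ s x != s y
       else exists2 f, joins f (h x) (h y) & sign f = s x (+) s y) ->
  homomorphic G (EDC B).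
Proof.
move=> hs; exists (switch S (@sign G)); split; first by exists S.
pose phi x : vertex (EDC B) := (h x, s x).
have [|fE fEP] := @choice (edge G) (edge (EDC B))
  (fun e a => joins a (phi (ends e).1) (phi (ends e).2) /\ sign a = switch S (@sign G) e).
  move=> e; have := hs e (ends e).1 (ends e).2.
  rewrite {1}/joins -surjective_pairing eqxx => /(_ isT).
  case: ifP => _ => [[hxy sxy]|[f fxy sf]].
    exists (inl (h (ends e).1)); split=> //; rewrite /joins /phi /= hxy.
    by move: sxy; case: (s _) (s _) => [] []; rewrite ?eqxx ?orbT.
  case/orP: fxy => /eqP Ef.
    exists (inr (f, s (ends e).1)); split=> //; rewrite /joins /phi /= Ef sf /=.
    by rewrite addKb eqxx.
  exists (inr (f, s (ends e).2)); split=> //; rewrite /joins /phi /= Ef sf /=.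
  by rewrite addbCA addbb addbF eqxx orbT.
exists phi, fE; split=> [e x y|e]; last by case: (fEP e).
have [J _] := fEP e.
by case/orP => /eqP E; rewrite E in J => //; rewrite joinsC.
Qed.

End ExtendedDoubleCover.

(** [S] collects the ends of negative walks from a base vertex; walks of both signs to one vertex
    would close into a negative closed walk. *)
Lemma balanced_potential (G : sgraph) : connected G ->
    (forall i j n, closed_walk_length G i j n -> ~~ i) ->
  exists S : {set vertex G}, forall e x y, joins e x y ->
    sign e = (x \in S) (+) (y \in S).
Proof.
move=> cG pos; have /rel_connectedP[[x0 _] _] := cG.
exists [set y | `[< exists n, signed_walk true x0 y n >]] => e x y exy.
have inS z i n : signed_walk i x0 z n ->
    (z \in [set y | `[< exists n, signed_walk true x0 y n >]]) = i.
  move=> wz; rewrite inE; apply/asboolP/idP => [[m wm]|]; last by case: i wz; [exists n|].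
  case: i wz => // wz; have /pos : closed_walk_length G true (odd (n + m)) (n + m).
    apply/closed_walk_lengthP; exists x0 => //.
    exact: signed_walk_cat wz (signed_walk_sym wm).
  by [].
have [i [n wx]] := signed_walk_exists x0 x cG.
rewrite (inS _ _ _ wx) (inS _ _ _ (signed_walk_cat wx (signed_walk_edge exy))).
by rewrite addKb.
Qed.

(** * Contraction of the negative edges *)

Section Contraction.
Variables (G : sgraph) (S : {set vertex G}) (n : nat) (F : vertex G -> 'I_n -> bool).
Hypotheses (SPG : SP G) (n_gt1 : 1 < n).
Hypothesis FE : forall e x y, joins e x y ->
  if switch S (@sign G) e then forall i, F x i (+) F y i
  else exists c, forall i, F x i (+) F y i = (i == c).

Let r : rel (vertex G) := fun x y => [exists e, joins e x y && switch S (@sign G) e].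
Let V := {x | roots r x}.

Let symr : connect_sym r.
Proof.
by apply: sym_connect_sym => x y; apply: eq_existsb => e; rewrite joinsC.
Qed.

Let pi x : V := Sub (root r x) (roots_root symr x).

Let pi_val (x : V) : pi (val x) = x.
Proof. by apply: val_inj; apply/eqP: (valP x). Qed.

Let pi_eq x y : (pi x == pi y) = connect r x y.
Proof. by rewrite -val_eqE /= root_connect. Qed.

(** Each negative edge complements the vector, so within a component vectors are equal or
    complementary. *)
Let F_connect x y : connect r x y -> exists a, forall i, F x i (+) F y i = a.
Proof.
case/connectP => p; elim: p x => [|z p IH] x /=.
  by move=> _ ->; exists false => i; rewrite addbb.
case/andP=> /existsP[e /andP[exz se]] pz lz.
have [a aE] := IH z pz lz; have := FE exz; rewrite se => zE.
by exists (~~ a) => i; rewrite -(aE i) -addTb -(zE i) addbA addbK.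
Qed.

Let F_pi x : exists a, forall i, F x i (+) F (val (pi x)) i = a.
Proof. exact/F_connect/connect_root. Qed.

(* [pi] contracts the components of the negative edges of [switch S sign]. *)
Let lifts (p : V * V) : bool := [exists e, exists x, exists y,
  [&& joins e x y, ~~ switch S (@sign G) e, pi x == p.1 & pi y == p.2]].

Let lifts_sym p q : lifts (p, q) -> lifts (q, p).
Proof.
case/existsP=> e /existsP[x /existsP[y /and4P[exy se xp yq]]].
by apply/existsP; exists e; apply/existsP; exists y; apply/existsP; exists x;
  rewrite joinsC exy se xp yq.
Qed.

(** Each adjacent pair is kept once, oriented by rank, which makes the contraction simple. *)
Let E := {p : V * V | (enum_rank p.1 < enum_rank p.2) && lifts p}.

Let G' : sgraph := @SGraph (@MGraph V E (fun e => val e))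
  (fun e => `[< exists c, forall i,
     F (val (val e).1) i (+) F (val (val e).2) i = (i != c) >]).

Let joinsG' (e : edge G') (x y : V) : joins e x y -> lifts (x, y).
Proof.
case: e => -[p q] pq; have /andP[_ lpq] := pq.
by case/orP => /eqP[<- <-]; [|apply: lifts_sym].
Qed.

(** A positive edge flips one coordinate but not a second one [d], so its ends are neither equal nor
    complementary. *)
Let lift_neq x y e : joins e x y -> ~~ switch S (@sign G) e -> pi x != pi y.
Proof.
move=> exy se; rewrite pi_eq; apply/negP => /F_connect[a aE].
have := FE exy; rewrite (negbTE se) => -[c cE].
have n_gt0 := ltnW n_gt1; have := aE c; rewrite cE eqxx => aT.
pose d := if val c == 0 then Ordinal n_gt1 else Ordinal n_gt0.
have := aE d; rewrite cE -aT -val_eqE /d; case: ifP => [/eqP->|] //=.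
by rewrite eq_sym => ->.
Qed.

Let edgeG' (x y : vertex G') : lifts (x, y) -> exists e : edge G', joins e x y.
Proof.
move=> lxy; have : x != y.
  by case/existsP: lxy => e /existsP[u /existsP[v /and4P[/lift_neq H /H + /eqP/= <- /eqP/= <-]]].
rewrite -(inj_eq enum_rank_inj) neq_ltn => /orP[lt|lt].
  have P : (enum_rank (x, y).1 < enum_rank (x, y).2) && lifts (x, y) by rewrite lt.
  by exists (Sub (x, y) P); rewrite /joins /= eqxx.
have P : (enum_rank (y, x).1 < enum_rank (y, x).2) && lifts (y, x) by rewrite lt lifts_sym.
by exists (Sub (y, x) P); rewrite /joins /= eqxx orbT.
Qed.

Let adjG' x y : @adjacent G' x y -> lifts (x, y).
Proof. by case/existsP => e; apply: joinsG'. Qed.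

Let lifts_pi e x y : joins e x y -> ~~ switch S (@sign G) e -> lifts (pi x, pi y).
Proof.
move=> exy se; apply/existsP; exists e; apply/existsP; exists x; apply/existsP; exists y.
by rewrite exy se !eqxx.
Qed.

Let SP_G' : SP G'.
Proof.
have /and3P[sG cG noK4] := SPG; apply/and3P; split.
- apply/andP; split; apply/forallP => -[[x y] Pe].
    have /andP[+ _] := Pe.
    by apply: contraTneq => /= ->; rewrite ltnn.
  apply/forallP => -[[x' y'] Pe']; apply/implyP => J; apply/eqP/val_inj.
  have /andP[/= lt _] := Pe; have /andP[/= lt' _] := Pe'.
  case/orP: J => /eqP[E1 E2]; first by rewrite /= E1 E2.
  by rewrite E1 E2 in lt'; have := ltn_trans lt lt'; rewrite ltnn.
- apply/rel_connectedP; split.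
    by have /rel_connectedP[[x _] _] := cG; exists (pi x); rewrite inE.
  move=> x y _ _; rewrite -(pi_val x) -(pi_val y).
  have /rel_connectedP[_ /(_ (val x) (val y) (in_setT _) (in_setT _))] := cG.
  case/connectP => p; elim: p (val x) => [|z p IH] u /=; first by move=> _ ->.
  case/andP=> /and3P[_ _ /existsP[e euz]] pz lz.
  apply: connect_trans (IH z pz lz).
  have [se|se] := boolP (switch S (@sign G) e).
    suff /eqP -> : pi u == pi z by [].
    by rewrite pi_eq; apply: connect1; apply/existsP; exists e; rewrite euz.
  apply: connect1; rewrite /induced /= !in_setT /=.
  by have [e' J] := edgeG' (lifts_pi euz se); apply/existsP; exists e'.
apply: contra noK4.
apply: (@clique_minor_lift _ _ (@adjacent G) (@adjacent G') (fun x => [set y | pi y == x])).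
- move=> x; rewrite (_ : [set y | _] = [set y | connect r (val x) y]).
    apply: component_connected => [u v|u v /existsP[e /andP[euv _]]].
      by apply: eq_existsb => e; rewrite joinsC.
    by apply/existsP; exists e.
  by apply/setP => y; rewrite !inE -{1}(pi_val x) eq_sym pi_eq.
- move=> x y xy; apply/pred0P => u; rewrite /= !inE; apply/negbTE/negP => /andP[/eqP->].
  by apply/negP.
- move=> x y /adjG' /existsP[e /existsP[u /existsP[v /and4P[euv _ ux vy]]]].
  by exists u, v; rewrite !inE; split=> //; apply/existsP; exists e.
Qed.

Let sign_G' (e : edge G') (x y : vertex G') : joins e x y ->
  exists c, forall i, F (val x) i (+) F (val y) i = (i == c) (+) sign e.
Proof.
move=> J.
suff [c cE] : exists c, forall i,
    F (val (val e).1) i (+) F (val (val e).2) i = (i == c) (+) sign e.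
  exists c => i; rewrite -cE.
  by case/orP: J => /eqP /= ->; rewrite // addbC.
rewrite /=; case: asboolP => [[c cE]|no].
  by exists c => i; rewrite cE addbT.
have /andP[_ /existsP[f /existsP[u /existsP[v /and4P[fuv sf /eqP pu /eqP pv]]]]] := valP e.
move: no; rewrite -pu -pv => no.
have [a aE] := F_pi u; have [b bE] := F_pi v.
have := FE fuv; rewrite (negbTE sf) => -[c cE].
have {}cE i : F (val (pi u)) i (+) F (val (pi v)) i = (i == c) (+) (a (+) b).
  by rewrite -(aE i) -(bE i) -cE; do 4!case: (F _ i).
case ab: (a (+) b) cE => cE; last by exists c.
by case: no; exists c => i; rewrite cE addbT.
Qed.

Lemma contraction : exists (H : sgraph) (p : vertex G -> vertex H) (FH : vertex H -> 'I_n -> bool),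
  [/\ SP H,
      forall e x y, joins e x y -> exists c, forall i, FH x i (+) FH y i = (i == c) (+) sign e,
      forall x, exists a, forall i, F x i (+) FH (p x) i = a
    & forall e x y, joins e x y ->
        if switch S (@sign G) e then p x = p y else exists f : edge H, joins f (p x) (p y)].
Proof.
exists G', pi, (fun x => F (val x)); split; first exact: SP_G'.
- exact: sign_G'.
- exact: F_pi.
- move=> e x y exy; case: ifP => se; last exact: edgeG' (lifts_pi exy (negbT se)).
  apply/eqP; rewrite pi_eq; apply: connect1.
  by apply/existsP; exists e; rewrite exy.
Qed.

End Contraction.

(** * Completeness of the double cover, by cases on the shortest negative closed walk of [B] *)

Theorem theorem5 (g : nat) (B : sgraph) :
  0 < g -> wide g B -> SP_complete B -> SP_complete (EDC B).
Proof.
move=> g0 wB cB G SPG GB; have /and3P[_ cG _] := SPG.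
have Bcl i j m : closed_walk_length B i j m -> j = i && odd g.
  move=> /((girth_geP _ _).1 wB)[m' _ /neg_cycle_closed_walk].
  by case: i => [[_ ->]|->].
have Gcl i j n : closed_walk_length G i j n ->
    exists2 m, m + i <= n & closed_walk_length B i (i (+) j) m.
  move=> /((girth_geP _ _).1 GB)[m mn /EDC_closed_walk[m' m'm cm']].
  by exists m' => //; apply: leq_trans mn.
have [exneg|noneg] := pselect (exists m, closed_walk_length B true (odd g) m); last first.
  have Gpos i j n : closed_walk_length G i j n -> ~~ i.
    case/Gcl => m _; case: i => // cm; case: noneg; exists m.
    by have E := Bcl _ _ _ cm; rewrite E in cm.
  have [|s' [[S' sE] [fV [fE [fJ fS]]]]] := cB G SPG.
    apply/girth_geP => i j n cn; have := Gpos _ _ _ cn; case: i cn => // /Gcl[m mn cm] _.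
    by exists m; first by rewrite addn0 in mn.
  have [S0 S0E] := balanced_potential cG Gpos.
  (* Switching by [S0] makes every edge positive, so the layer must change exactly along edges with
     negative image; adding [S0] to [S'] achieves this. *)
  apply: (@homomorphic_EDC B G S0 fV (fun x => (x \in S') (+) (x \in S0))) => e x y exy.
  rewrite /switch (cut_joins _ exy) -(S0E _ _ _ exy) addbb.
  exists (fE e); first exact: fJ.
  by rewrite fS sE /switch (cut_joins _ exy) (S0E _ _ _ exy) addbC addbACA.
case: (ex_minnP exneg) => n cn min {exneg}.
have on : odd n = odd g by have /closed_walk_lengthP[] := cn.
have n0 : 0 < n.
  rewrite lt0n; apply/eqP => E; have /closed_walk_lengthP[x [p [_ + sp]] _] := cn.
  by rewrite E in sp; rewrite (size0nil sp) walk_sign_nil.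
have [|S [F FE]] := @cube_map G n n0 SPG.
  move=> i j m /Gcl[m' m'm cm']; have := Bcl _ _ _ cm'; case: i cm' m'm => /= cm' m'm jE.
    rewrite jE in cm'; split; first by apply: leq_ltn_trans (min _ cm') _; rewrite -addn1.
    by rewrite on -jE negbK.
  exact: jE.
pose i0 := Ordinal n0.
(* [B] has a negative loop; the single coordinate serves as layer. *)
have [n1|n1] := eqVneq n 1.
  have /closed_walk_lengthP[x [p [+ + sp]] _] := cn; rewrite n1 in sp.
  case: p sp => [|[f y] [|]] //= _ /andP[fx /eqP E]; rewrite {}E in fx *.
  rewrite walk_sign_cons walk_sign_nil addbF /= => sf.
  apply: (@homomorphic_EDC B G S (fun=> x) (F^~ i0)) => e u v euv.
  have := FE _ _ _ euv; case: ifP => _ H.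
    by have := H i0; case: (F u i0); case: (F v i0).
  have [c cE] := H; exists f => //; rewrite sf cE; apply/esym/eqP/val_inj.
  by have := ltn_ord c; rewrite /=; lia.
(* [fb] offers an edge of either sign between [x] and [y]. A positive edge changes the sum of the
   two coordinates, a negative one preserves it, so this sum chooses between [x] and [y]. *)
have [n2|n2] := eqVneq n 2.
  have /closed_walk_lengthP[x [p [+ + sp]] _] := cn; rewrite n2 in sp.
  case: p sp => [|[f y] [|[f' x'] [|]]] //= _ /and3P[fxy fyx /eqP E].
  rewrite {}E joinsC in fyx.
  rewrite !walk_sign_cons walk_sign_nil addbF /= => sf.
  have n1' : 1 < n by rewrite n2.
  pose i1 := Ordinal n1'.
  have i01 (i : 'I_n) : (i == i0) = (i != i1).
    by have := ltn_ord i; rewrite -!val_eqE /=; lia.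
  have fb b : exists2 f, joins f x y & sign f = b.
    move: sf; case fE: (sign f); [case: b|case: b; case f'E: (sign f') => // _].
    - by exists f.
    - by case f'E: (sign f') => // _; exists f'.
    - by exists f'.
    - by exists f.
  apply: (@homomorphic_EDC B G S (fun v => if F v i0 (+) F v i1 then y else x) (F^~ i0)).
  move=> e u v euv; have := FE _ _ _ euv; case: ifP => _ H.
    have := H i0; have := H i1.
    by case: (F u i0) (F v i0) (F u i1) (F v i1) => [] [] [] [].
  have [c cE] := H; have := cE i0; have := cE i1.
  rewrite [i0 == c]eq_sym [i1 == c]eq_sym i01.
  have [f1 J1 s1] := fb (F u i0 (+) F v i0).
  have J1' : joins f1 y x by rewrite joinsC.
  move=> E1 E0; exists f1 => //; move: E1 E0.
  by case: (F u i0) (F v i0) (F u i1) (F v i1) (c == i1) => [] [] [] [] [].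
have n3 : 2 < n by move/eqP: n1; move/eqP: n2; lia.
have [H [p [FH [SPH FHE Fp He]]]] := contraction SPG (ltnW n3) FE.
have [|s' [[S' sE] [fV [fE [fJ fS]]]]] := cB H SPH.
  apply/girth_geP => i j m /(cube_closed_walk FHE); case: i.
    by rewrite on => -[nm ->]; exists n.
  (* A positive closed walk is matched by the trivial walk of length 0. *)
  move=> ->; exists 0 => //; have /closed_walk_lengthP[x _ _] := cn.
  apply/closed_walk_lengthP; exists x => //; exists [::].
  by rewrite /= eqxx walk_sign_nil.
pose a x := F x i0 (+) FH (p x) i0.
have aE x i : F x i (+) FH (p x) i = a x.
  by have [b bE] := Fp x; rewrite /a !bE.
(* [a] tells whether the vector of [x] is complementary to that of its contracted vertex; adding
   [S'] absorbs the switching of [H]. *)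
apply: (@homomorphic_EDC B G S (fun x => fV (p x)) (fun x => (p x \in S') (+) a x)).
move=> e x y exy; have := FE _ _ _ exy; have := He _ _ _ exy.
case: ifP => _ => [pxy H1|[f fxy] [c cE]].
  rewrite pxy /a pxy; split=> //; have := H1 i0.
  by case: (_ \in _) (F x i0) (F y i0) (FH _ _) => [] [] [] [].
exists (fE f); first exact: fJ.
rewrite fS sE /switch (cut_joins _ fxy) addbACA addbC; congr addb.
have [c' c'E] := FHE _ _ _ fxy.
(* As [n > 2], some coordinate is singled out neither in [G] nor in [H]; there [F x] and [F y]
   agree, so the change of [a] is the sign of [f]. *)
have [i ic ic'] : exists2 i, i != c & i != c'.
  have /card_gt0P[i] : 0 < #|~: [set c; c']|.
    rewrite cardsCs setCK card_ord subn_gt0; apply: leq_ltn_trans n3.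
    by rewrite cards2; case: eqP.
  by rewrite !inE negb_or => /andP[? ?]; exists i.
have := c'E i; rewrite (negbTE ic') /= => <-.
rewrite -(aE x i) -(aE y i) addbACA cE (negbTE ic) //.
Qed.
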